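(* Let $f:\mathbb{R}^n\times\mathbb{R}^m\to\mathbb{R}^n$ be continuously differentiable with $f(0,0)=0$. Let $\Psi:\mathbb{R}^n\to\mathbb{R}^{n_z}$ ($n_z\ge n$) be continuous with $\Psi(0)=0$, and let $A\in\mathbb{R}^{n_z\times n_z}$, $B\in\mathbb{R}^{n_z\times m}$, $C\in\mathbb{R}^{n\times n_z}$ be such that $C\Psi(x)=x$ for all $x\in\mathbb{R}^n$, the pair $(A,B)$ is stabilizable and the pair $(A,C)$ is observable. Let $Q\in\mathbb{R}^{n\times n}$ and $R\in\mathbb{R}^{m\times m}$ be symmetric positive definite and put $l(x,u)=x^{\mathsf T}Qx+u^{\mathsf T}Ru$. Suppose the modeling error vanishes identically, i.e. $\Psi(f(x,u))=A\Psi(x)+Bu$ for all $x\in\mathbb{R}^n$, $u\in\mathbb{R}^m$. Consider, for an initial state $x\in\mathbb{R}^n$ at time $t$, the infinite-horizon optimal control problem $$\min_{(u_t,u_{t+1},\ldots)}\ \sum_{k=0}^{\infty} l(x_{t+k},u_{t+k})\quad\text{subject to}\quad x_{t+k+1}=f(x_{t+k},u_{t+k}),\ k\in\mathbb{Z}_{\ge 0},\quad x_t=x.$$ Then this problem has a globally optimal feedback policy, given by $$u_{t+k}=K\Psi(x_{t+k}),\qquad k\in\mathbb{Z}_{\ge 0},$$ where $K=-(R+B^{\mathsf T}PB)^{-1}B^{\mathsf T}PA$ and $P$ is the unique positive definite solution of the Riccati equation $$P=C^{\mathsf T}QC+A^{\mathsf T}PA-A^{\mathsf T}PB(R+B^{\mathsf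 T}PB)^{-1}B^{\mathsf T}PA.$$
   Context: ''Globally optimal feedback policy'' means that, for every initial state $x$, the input sequence generated by the policy along the closed-loop trajectory $x_{t+k+1}=f(x_{t+k},K\Psi(x_{t+k}))$ attains the minimum of the cost over all input sequences. The matrix $K$ is the optimal LQR gain for the lifted linear problem of minimizing $\sum_{k\ge 0} l(Cz_{t+k},u_{t+k})$ subject to $z_{t+k+1}=Az_{t+k}+Bu_{t+k}$, $z_t=\Psi(x)$. *)

(* Defs.v *)
From mathcomp Require Import all_boot all_order all_algebra.
From mathcomp Require Import complex.
From mathcomp Require Import all_classical all_reals all_analysis.

Set Implicit Arguments.
Unset Strict Implicit.
Unset Printing Implicit Defensive.

Import Order.TTheory GRing.Theory Num.Theory.
Import numFieldNormedType.Exports.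

Local Open Scope classical_set_scope.
Local Open Scope ring_scope.

(* The inequality is continuity of [p |-> 'd f p] for the operator norm.      *)
Definition continuously_differentiable (R : realType) (V W : normedModType R)
    (f : V -> W) : Prop :=
  (forall p : V, differentiable f p) /\
  (forall (p : V) (e : R), 0 < e ->
     \forall q \near p, forall v : V, `|'d f q v - 'd f p v| <= e * `|v|).

Definition qform (R : realType) (d : nat) (M : 'M[R]_d) (v : 'cV[R]_d) : R :=
  (v^T *m M *m v) 0 0.

Definition posdef (R : realType) (d : nat) (M : 'M[R]_d) : Prop :=
  M^T = M /\ (forall v : 'cV[R]_d, v != 0 -> 0 < qform M v).

(* The modulus of a complex number is valued in [R[i]], and a comparison      *)
(* there with 1 compares the real parts, the imaginary parts being zero.      *)
Definition schur_stable (R : realType) (d : nat) (M : 'M[R]_d) : Prop :=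
  forall lambda : R[i],
    eigenvalue (map_mx (real_complex R) M) lambda -> `|lambda| < 1.

Definition stabilizable (R : realType) (d m : nat)
    (A : 'M[R]_d) (B : 'M[R]_(d, m)) : Prop :=
  exists F : 'M[R]_(m, d), schur_stable (A + B *m F).

(* Distinct initial states of z_{k+1} = A z_k have distinct outputs C z_k.    *)
Definition observable (R : realType) (d n : nat)
    (A : 'M[R]_d) (C : 'M[R]_(n, d)) : Prop :=
  forall z1 z2 : 'cV[R]_d,
    (forall k : nat, C *m iter k (mulmx A) z1 = C *m iter k (mulmx A) z2) ->
    z1 = z2.

Definition stage_cost (R : realType) (n m : nat) (Q : 'M[R]_n) (W : 'M[R]_m)
    (x : 'cV[R]_n) (u : 'cV[R]_m) : R :=
  qform Q x + qform W u.

(* The dynamics are time invariant: index k stands for time t + k.            *)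
Fixpoint trajectory (R : realType) (n m : nat)
    (f : 'cV[R]_n * 'cV[R]_m -> 'cV[R]_n) (x : 'cV[R]_n)
    (u : nat -> 'cV[R]_m) (k : nat) : 'cV[R]_n :=
  if k is k'.+1 then f (trajectory f x u k', u k') else x.

Definition closed_loop (R : realType) (n m : nat)
    (f : 'cV[R]_n * 'cV[R]_m -> 'cV[R]_n) (mu : 'cV[R]_n -> 'cV[R]_m)
    (x : 'cV[R]_n) (k : nat) : 'cV[R]_n :=
  iter k (fun y => f (y, mu y)) x.

Definition total_cost (R : realType) (n m : nat)
    (f : 'cV[R]_n * 'cV[R]_m -> 'cV[R]_n)
    (l : 'cV[R]_n -> 'cV[R]_m -> R) (x : 'cV[R]_n)
    (u : nat -> 'cV[R]_m) : \bar R :=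
  (\sum_(0 <= k <oo) (l (trajectory f x u k) (u k))%:E)%E.

(* Input sequences of infinite cost are allowed as competitors, but the       *)
(* minimum itself has to be a real number.                                    *)
Definition globally_optimal_policy (R : realType) (n m : nat)
    (f : 'cV[R]_n * 'cV[R]_m -> 'cV[R]_n)
    (l : 'cV[R]_n -> 'cV[R]_m -> R) (mu : 'cV[R]_n -> 'cV[R]_m) : Prop :=
  forall x : 'cV[R]_n,
    let ustar := fun k : nat => mu (closed_loop f mu x k) in
    total_cost f l x ustar \is a fin_num /\
    (forall u : nat -> 'cV[R]_m,
       (total_cost f l x ustar <= total_cost f l x u)%E).

(* [invmx] returns a singular matrix unchanged, but for positive definite W and *)
(* P the matrix W + B^T P B is invertible.                                    *)
Definition riccati (R : realType) (d n m : nat) (A : 'M[R]_d)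
    (B : 'M[R]_(d, m)) (C : 'M[R]_(n, d)) (Q : 'M[R]_n) (W : 'M[R]_m)
    (P : 'M[R]_d) : Prop :=
  P = C^T *m Q *m C + A^T *m P *m A
      - A^T *m P *m B *m invmx (W + B^T *m P *m B) *m B^T *m P *m A.

Definition lqr_gain (R : realType) (d m : nat) (A : 'M[R]_d)
    (B : 'M[R]_(d, m)) (W : 'M[R]_m) (P : 'M[R]_d) : 'M[R]_(m, d) :=
  - (invmx (W + B^T *m P *m B) *m B^T *m P *m A).

(* Main.v *)
Require Import Defs.
From mathcomp Require Import all_boot all_order all_algebra.
From mathcomp Require Import complex.
From mathcomp Require Import all_classical all_reals all_analysis.
From mathcomp Require Import ring lra.
Import Order.TTheory GRing.Theory Num.Theory.
Import numFieldNormedType.Exports.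
Local Open Scope classical_set_scope.
Local Open Scope ring_scope.

Set Implicit Arguments.
Unset Strict Implicit.

(** Since [Psi] intertwines [f] with the linear map [A z + B u] and [C Psi x = x],
    every input sequence costs the same for the nonlinear system started at [x]
    as for the linear system started at [Psi x]. It remains to solve the linear
    quadratic problem, and to transport its optimal feedback back.

    The tool is the completion of squares [completion_of_squares]: minimizing a
    stage cost plus a quadratic terminal cost [P] over one input gives the
    quadratic form of [riccati_map P], attained at the gain of [P]. Iterating
    from [0] gives the optimal cost [value_iter N] of each finite horizon. This
    sequence is nondecreasing, and a stabilizing feedback bounds it
    ([value_iter_bounded]); so it converges to some [P] ([value_iter_cvg]), a
    fixed point of the Riccati map because matrix inversion is continuous.
    Observability makes [P] positive definite ([fixpoint_posdef]).

    The bound needs the powers of a Schur stable matrix to be absolutely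
    summable. This is read off from Cayley-Hamilton, removing the linear factors
    of the characteristic polynomial one at a time ([summable_powers]).

    Optimality: [N] steps of any input sequence cost at least [value_iter N],
    hence an infinite sequence costs at least the limit [P]; [N] steps of the
    feedback cost [qform P (z 0) - qform P (z N)], at most [qform P (z 0)].

    Uniqueness: squeezing between these two bounds shows that [P] vanishes along
    its own closed loop ([closed_loop_value_vanishes]). Since a positive definite
    form dominates any other, so does every other solution [P'], whence [P' <= P];
    and [P <= P'] as [P'] lies above all value iterates ([limit_unique]). *)

(** * Bilinear and quadratic forms of a matrix *)

Section BilinearForms.
Context {R : realType}.
Implicit Types p q d m : nat.

Definition bform {p q} (M : 'M[R]_(p, q)) (u : 'cV[R]_p) (v : 'cV[R]_q) : R :=
  (u^T *m M *m v) 0 0.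

Lemma qformE {d} (M : 'M[R]_d) (v : 'cV[R]_d) : qform M v = bform M v v.
Proof. by []. Qed.

Lemma bform_sumE {p q} (M : 'M[R]_(p, q)) u v :
  bform M u v = \sum_i \sum_j u i 0 * M i j * v j 0.
Proof.
rewrite /bform mxE exchange_big; apply: eq_bigr => j _.
by rewrite !mxE mulr_suml; apply: eq_bigr => i _; rewrite mxE.
Qed.

Lemma bformC {p q} (M : 'M[R]_(p, q)) u v : bform M u v = bform M^T v u.
Proof.
have -> : bform M^T v u = (u^T *m M *m v)^T 0 0.
  by rewrite /bform !trmx_mul trmxK mulmxA.
by rewrite [RHS]mxE.
Qed.

Lemma bformDl {p q} (M : 'M[R]_(p, q)) u1 u2 v :
  bform M (u1 + u2) v = bform M u1 v + bform M u2 v.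
Proof. by rewrite /bform linearD /= !mulmxDl mxE. Qed.

Lemma bformDr {p q} (M : 'M[R]_(p, q)) u v1 v2 :
  bform M u (v1 + v2) = bform M u v1 + bform M u v2.
Proof. by rewrite /bform mulmxDr mxE. Qed.

Lemma bformZl {p q} (M : 'M[R]_(p, q)) a u v :
  bform M (a *: u) v = a * bform M u v.
Proof. by rewrite /bform linearZ /= -!scalemxAl mxE. Qed.

Lemma bformZr {p q} (M : 'M[R]_(p, q)) a u v :
  bform M u (a *: v) = a * bform M u v.
Proof. by rewrite /bform -scalemxAr mxE. Qed.

Lemma bformD {p q} (M N : 'M[R]_(p, q)) u v :
  bform (M + N) u v = bform M u v + bform N u v.
Proof. by rewrite /bform mulmxDr mulmxDl mxE. Qed.

Lemma bformN {p q} (M : 'M[R]_(p, q)) u v : bform (- M) u v = - bform M u v.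
Proof. by rewrite /bform mulmxN mulNmx mxE. Qed.

Lemma bform_mulr {p q m} (M : 'M[R]_(p, q)) (N : 'M[R]_(q, m)) u v :
  bform M u (N *m v) = bform (M *m N) u v.
Proof. by rewrite /bform !mulmxA. Qed.

Lemma bform_mull {p q m} (M : 'M[R]_(p, q)) (N : 'M[R]_(p, m)) u v :
  bform M (N *m u) v = bform (N^T *m M) u v.
Proof. by rewrite /bform trmx_mul !mulmxA. Qed.

Lemma bform_delta {p q} (M : 'M[R]_(p, q)) i j :
  bform M (delta_mx i 0) (delta_mx j 0) = M i j.
Proof. by rewrite /bform trmx_delta -rowE -colE !mxE. Qed.

Lemma qform_mul {p q} (M : 'M[R]_p) (N : 'M[R]_(p, q)) v :
  qform M (N *m v) = qform (N^T *m M *m N) v.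
Proof. by rewrite !qformE bform_mull bform_mulr. Qed.

Lemma qformD {d} (M N : 'M[R]_d) v : qform (M + N) v = qform M v + qform N v.
Proof. exact: bformD. Qed.

Lemma qform_add {d} (M : 'M[R]_d) u v : M^T = M ->
  qform M (u + v) = qform M u + 2 * bform M u v + qform M v.
Proof.
move=> symM; rewrite !qformE bformDl !bformDr (bformC M v u) symM; ring.
Qed.

Lemma qform0 {d} (M : 'M[R]_d) : qform M 0 = 0.
Proof. by rewrite /qform mulmx0 mxE. Qed.

Lemma qform0l {d} (v : 'cV[R]_d) : qform 0 v = 0.
Proof. by rewrite /qform mulmx0 mul0mx mxE. Qed.

(** A symmetric matrix is recovered from its quadratic form. This turns
    comparisons and limits of quadratic forms into statements on matrices. *)
Lemma polarization {d} (M : 'M[R]_d) i j : M^T = M ->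
  M i j = 2^-1 * (qform M (delta_mx i 0 + delta_mx j 0)
                  - qform M (delta_mx i 0) - qform M (delta_mx j 0)).
Proof. by move=> /qform_add ->; rewrite bform_delta; field. Qed.

Lemma qform_inj {d} (M N : 'M[R]_d) : M^T = M -> N^T = N ->
  (forall v, qform M v = qform N v) -> M = N.
Proof.
by move=> sM sN eqMN; apply/matrixP => i j; rewrite !polarization // !eqMN.
Qed.

Definition psd {d} (M : 'M[R]_d) : Prop :=
  M^T = M /\ (forall v, 0 <= qform M v).

Lemma posdef_psd {d} (M : 'M[R]_d) : posdef M -> psd M.
Proof.
case=> sM pM; split=> // v; have [->|/pM/ltW//] := eqVneq v 0.
by rewrite qform0.
Qed.

Lemma psd_congr {p q} (M : 'M[R]_p) (N : 'M[R]_(p, q)) :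
  psd M -> psd (N^T *m M *m N).
Proof.
case=> sM pM; split=> [|v]; first by rewrite !trmx_mul trmxK sM mulmxA.
by rewrite -qform_mul.
Qed.

Lemma posdefD_psd {d} (M N : 'M[R]_d) : posdef M -> psd N -> posdef (M + N).
Proof.
move=> [sM pM] [sN pN]; split=> [|v v0]; first by rewrite linearD /= sM sN.
by rewrite qformD ltr_wpDr // pM.
Qed.

Lemma posdef_unitmx {d} (M : 'M[R]_d) : posdef M -> M \in unitmx.
Proof.
move=> [sM pM]; rewrite -row_free_unit -kermx_eq0; apply/rowV0P => v.
move=> /sub_kermxP vM; apply/eqP; apply: contraT => v0.
have := pM v^T; rewrite /qform trmxK vM mul0mx mxE ltxx.
by move=> /(_ _); apply; rewrite trmx_eq0.
Qed.

Lemma posdef_eq0 {d} (M : 'M[R]_d) v : posdef M -> qform M v = 0 -> v = 0.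
Proof.
by move=> [_ pM] Mv0; apply/eqP; apply: contraT => /pM; rewrite Mv0 ltxx.
Qed.

(** The quadratic polynomial [t |-> qform M (t *: u + v)] is nonnegative. If
    [qform M u = 0] it is affine in [t], hence constant; otherwise its minimum
    gives the inequality. *)
Lemma cauchy_schwarz {d} (M : 'M[R]_d) u v : psd M ->
  bform M u v ^+ 2 <= qform M u * qform M v.
Proof.
move=> [sM pM].
have quad t : 0 <= t ^+ 2 * qform M u + 2 * t * bform M u v + qform M v.
  have := pM (t *: u + v); rewrite qform_add // qformE bformZl bformZr -qformE.
  by rewrite bformZl; congr (_ <= _); ring.
have [u0|u0] := eqVneq (qform M u) 0.
  (* the affine polynomial would take the value -1 at this t *)
  have q0 := quad (- (qform M v + 1) / (2 * bform M u v)).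
  have [->|b0] := eqVneq (bform M u v) 0; first by rewrite u0 mul0r expr0n.
  move: q0; rewrite u0 mulr0 add0r.
  have -> : 2 * (- (qform M v + 1) / (2 * bform M u v)) * bform M u v
          = - (qform M v + 1) by field.
  by rewrite opprD addrAC addNr add0r oppr_ge0 ler10.
have u_gt0 : 0 < qform M u by rewrite lt_neqAle eq_sym u0 pM.
(* the minimizer of the polynomial *)
have := quad (- bform M u v / qform M u).
have -> : (- bform M u v / qform M u) ^+ 2 * qform M u +
   2 * (- bform M u v / qform M u) * bform M u v + qform M v
   = (qform M u * qform M v - bform M u v ^+ 2) / qform M u by field.
by rewrite pmulr_lge0 ?invr_gt0 // subr_ge0.
Qed.

(** The [i]-th coordinate of [v] is the [M]-inner product of [v] with
    [M^-1 e_i], so Cauchy-Schwarz bounds it. *)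
Lemma posdef_coord_bound {d} (M : 'M[R]_d) i : posdef M ->
  exists c, forall v : 'cV[R]_d, v i 0 ^+ 2 <= c * qform M v.
Proof.
move=> pM; have [sM M_ge0] := posdef_psd pM.
exists (qform M (invmx M *m delta_mx i 0)) => v.
suff <- : bform M (invmx M *m delta_mx i 0) v = v i 0.
  exact: cauchy_schwarz (posdef_psd pM).
rewrite bform_mull trmx_inv sM mulVmx ?posdef_unitmx //.
by rewrite /bform mulmx1 trmx_delta -rowE mxE.
Qed.

(** A positive definite form dominates every other one up to a factor, so that
    a state whose [M]-value tends to 0 also has vanishing [G]-value. *)
Lemma qform_le_posdef {d} (G M : 'M[R]_d) : posdef M ->
  exists c, forall v, qform G v <= c * qform M v.
Proof.
move=> pM.
have /choice[c c_bound] := fun i => posdef_coord_bound i pM.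
(* from |v_i v_j| <= (v_i^2 + v_j^2) / 2 *)
exists (\sum_i \sum_j `|G i j| * ((c i + c j) / 2)) => v.
rewrite qformE bform_sumE mulr_suml; apply: ler_sum => i _.
rewrite mulr_suml; apply: ler_sum => j _.
rewrite mulrAC (le_trans (ler_norm _)) // normrM (mulrC `|_|) -mulrA.
rewrite ler_wpM2l //.
have := c_bound i v; have := c_bound j v; have := sqr_ge0 (`|v i 0| - `|v j 0|).
rewrite sqrrB !real_normK ?num_real // normrM mulrDl.
move: (`|_| * `|_|) => ab; lra.
Qed.

End BilinearForms.

(** * Entrywise limits of matrices *)

Section EntrywiseLimits.
Context {R : realType}.
Implicit Types p q d m : nat.

Lemma cvg_sum_fin (I : finType) (X : I -> nat -> R) (L : I -> R) :
  (forall i, X i k @[k --> \oo] --> L i) ->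
  \sum_i X i k @[k --> \oo] --> \sum_i L i.
Proof.
by move=> XL; exact: (cvg_big (@add_continuous R) _ (fun i _ => XL i)).
Qed.

Lemma cvg_prod_fin (I : finType) (X : I -> nat -> R) (L : I -> R) :
  (forall i, X i k @[k --> \oo] --> L i) ->
  \prod_i X i k @[k --> \oo] --> \prod_i L i.
Proof.
by move=> XL; exact: (cvg_big (@mul_continuous R) _ (fun i _ => XL i)).
Qed.

Definition mx_cvg {p q} (X : nat -> 'M[R]_(p, q)) (L : 'M[R]_(p, q)) : Prop :=
  forall i j, X k i j @[k --> \oo] --> L i j.

Lemma mx_cvg_cst {p q} (L : 'M[R]_(p, q)) : mx_cvg (fun=> L) L.
Proof. by move=> i j; exact: cvg_cst. Qed.

Lemma mx_cvgD {p q} (X Y : nat -> 'M[R]_(p, q)) L M :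
  mx_cvg X L -> mx_cvg Y M -> mx_cvg (fun k => X k + Y k) (L + M).
Proof.
move=> XL YM i j; under eq_fun do rewrite mxE.
by rewrite mxE; apply: cvgD.
Qed.

Lemma mx_cvgN {p q} (X : nat -> 'M[R]_(p, q)) L :
  mx_cvg X L -> mx_cvg (fun k => - X k) (- L).
Proof.
move=> XL i j; under eq_fun do rewrite mxE.
by rewrite mxE; apply: cvgN.
Qed.

Lemma mx_cvgM {p q m} (X : nat -> 'M[R]_(p, q)) (Y : nat -> 'M[R]_(q, m)) L M :
  mx_cvg X L -> mx_cvg Y M -> mx_cvg (fun k => X k *m Y k) (L *m M).
Proof.
move=> XL YM i j; under eq_fun do rewrite mxE.
rewrite mxE; apply: cvg_sum_fin => l.
by apply: cvgM.
Qed.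

Lemma cvg_det {d} (X : nat -> 'M[R]_d) L :
  mx_cvg X L -> \det (X k) @[k --> \oo] --> \det L.
Proof.
move=> XL; apply: cvg_sum_fin => s.
apply: cvgM; first exact: cvg_cst.
by apply: cvg_prod_fin => i; exact: XL.
Qed.

(** Cramer's rule makes the entries of the inverse quotients of polynomials in
    the entries of the matrix. *)
Lemma mx_cvg_inv {d} (X : nat -> 'M[R]_d) L :
  (forall k, X k \in unitmx) -> L \in unitmx ->
  mx_cvg X L -> mx_cvg (fun k => invmx (X k)) (invmx L).
Proof.
move=> uX uL XL i j; rewrite /invmx uL; under eq_fun do rewrite uX mxE.
rewrite mxE; apply: cvgM.
  apply: cvgV; last exact: cvg_det.
  by rewrite -unitfE -unitmxE.
under eq_fun do rewrite mxE /cofactor.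
rewrite mxE /cofactor; apply: cvgM; first exact: cvg_cst.
apply: cvg_det => k l; under eq_fun do rewrite !mxE.
by rewrite !mxE; exact: XL.
Qed.

Lemma cvg_bform {p q} (X : nat -> 'M[R]_(p, q)) L u v :
  mx_cvg X L -> bform (X k) u v @[k --> \oo] --> bform L u v.
Proof.
move=> XL; apply: (mx_cvgM _ (mx_cvg_cst (L := v))).
exact: (mx_cvgM (mx_cvg_cst (L := u^T))).
Qed.

Lemma mx_cvg_sym {d} (X : nat -> 'M[R]_d) L :
  (forall k, (X k)^T = X k) -> mx_cvg X L -> L^T = L.
Proof.
move=> sX XL; apply/matrixP => i j; rewrite mxE.
have symE : (fun k => X k i j) = (fun k => X k j i).
  by apply/funext => k; rewrite -[in LHS]sX mxE.
apply: (@cvg_unique _ _ (X k i j @[k --> \oo])) => //.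
  by rewrite symE; exact: XL.
exact: XL.
Qed.

(** For each vector the values converge as a bounded nondecreasing sequence of
    reals; polarization transfers this to the entries. *)
Lemma monotone_qform_cvg {d} (X : nat -> 'M[R]_d) (b : 'cV[R]_d -> R) :
  (forall k, (X k)^T = X k) ->
  (forall k v, qform (X k) v <= qform (X k.+1) v) ->
  (forall k v, qform (X k) v <= b v) ->
  exists L, mx_cvg X L.
Proof.
move=> sX incX bX.
have cv v : cvgn (fun k => qform (X k) v).
  apply: nondecreasing_is_cvgn.
    by apply/nondecreasing_seqP => k; exact: incX.
  by exists (b v) => _ [k _ <-].
pose l v := limn (fun k => qform (X k) v).
pose L i j := 2^-1 * (l (delta_mx i 0 + delta_mx j 0)
                      - l (delta_mx i 0) - l (delta_mx j 0)).
exists (\matrix_(i, j) L i j) => i j.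
rewrite mxE; under eq_fun do rewrite polarization //.
apply: cvgM; first exact: cvg_cst.
by apply: cvgB; [apply: cvgB|]; exact: cv.
Qed.

End EntrywiseLimits.

(** * Summability of the powers of a Schur stable matrix *)

Section Summability.
Context {R : realType}.
Local Notation C := R[i].

(** Absolute convergence, as boundedness of the partial sums. The bound lives in
    [R[i]], where being above a real number forces [c] to be real. *)
Definition summable_mx {p q} (X : nat -> 'M[C]_(p, q)) : Prop :=
  forall i j, exists c, forall N, \sum_(k < N) `|X k i j| <= c.

(** With [S] the sum of the [`|s k|] for [k < N], the triangle inequality gives
    [S <= `|s 0| + `|lambda| * S + c], which is solved for [S]. *)
Lemma summable_recurrence (lambda : C) (s : nat -> C) c :
  `|lambda| < 1 ->
  (forall N, \sum_(k < N) `|s k.+1 - lambda * s k| <= c) ->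
  forall N, \sum_(k < N) `|s k| <= (`|s 0%N| + c) / (1 - `|lambda|).
Proof.
move=> lam1 sum_le N; rewrite ler_pdivlMr ?subr_gt0 //.
rewrite mulrBr mulr1 lerBlDr.
apply: (@le_trans _ _ (\sum_(k < N.+1) `|s k|)).
  by rewrite big_ord_recr /= lerDl.
rewrite big_ord_recl /= -addrA lerD2l mulr_suml.
apply: le_trans (lerD (sum_le N) (lexx _)); rewrite -big_split /=.
apply: ler_sum => k _.
rewrite -{1}(subrK (lambda * s k) (s k.+1)).
by rewrite (le_trans (ler_normD _ _)) // normrM (mulrC `|s k|).
Qed.

(** Multiplying [p] by ['X - lambda] turns the sequence [s k = p(M) M^k] into
    [s k.+1 - lambda s k]; so the linear factors can be stripped off one by one
    with the scalar recurrence. *)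
Lemma summable_horner_factors {d} (M : 'M[C]_d.+1) (r : seq C) p :
  {in r, forall lambda, `|lambda| < 1} ->
  summable_mx (fun k => horner_mx M (p * \prod_(z <- r) ('X - z%:P)) * M ^+ k) ->
  summable_mx (fun k => horner_mx M p * M ^+ k).
Proof.
elim: r p => [|lam r IHr] p r_lt1.
  by rewrite big_nil mulr1.
rewrite big_cons mulrA => /IHr sum_p i j.
have [|c le_c] := sum_p _ i j.
  by move=> z zr; apply: r_lt1; rewrite inE zr orbT.
exists ((`|(horner_mx M p * M ^+ 0) i j| + c) / (1 - `|lam|)).
pose s k := (horner_mx M p * M ^+ k) i j.
apply: (@summable_recurrence lam s); first by apply: r_lt1; rewrite mem_head.
move=> N; apply: le_trans (le_c N); apply: ler_sum => k _.
rewrite rmorphM rmorphB /= horner_mx_X horner_mx_C -mulrA mulrBl -exprS.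
suff -> : horner_mx M p * (M ^+ k.+1 - lam%:M * M ^+ k)
        = horner_mx M p * M ^+ k.+1 - lam *: (horner_mx M p * M ^+ k).
  have mxB (X Y : 'M[C]_d.+1) : (X - lam *: Y) i j = X i j - lam * Y i j.
    by rewrite !mxE.
  by rewrite mxB.
by rewrite mulrBr -scalemx1 -scalerAl mul1r -scalerAr.
Qed.

(** By Cayley-Hamilton the sequence for [p = char_poly M] is identically zero;
    stripping the eigenvalues off leads to [p = 1]. *)
Lemma summable_powers {d} (M : 'M[C]_d.+1) :
  (forall lambda, eigenvalue M lambda -> `|lambda| < 1) ->
  summable_mx (fun k => M ^+ k).
Proof.
move=> M_lt1; have [r Dr] := closed_field_poly_normal (char_poly M).
move: Dr; rewrite (monicP (char_poly_monic M)) scale1r => Dr.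
have <- : (fun k => horner_mx M 1 * M ^+ k) = (fun k => M ^+ k).
  by apply/funext => k; rewrite rmorph1 mul1r.
apply: (@summable_horner_factors _ _ r).
  move=> z zr; apply: M_lt1; rewrite eigenvalue_root_char Dr.
  by rewrite root_prod_XsubC.
rewrite mul1r -Dr Cayley_Hamilton => i j; exists 0 => N.
by rewrite big1 // => k _; rewrite mul0r mxE normr0.
Qed.

(** The eigenvalues are complex, so the powers are summed over [R[i]] and the
    bound is brought back to [R] through the real part. *)
Lemma schur_stable_summable {d} (M : 'M[R]_d) (z : 'cV[R]_d) i :
  schur_stable M ->
  exists c, forall N, \sum_(k < N) `|iter k (mulmx M) z i 0| <= c.
Proof.
case: d M z i => [|d] M z i stM; first by case: i.
have sumM := summable_powers stM.
have {}sumM j : exists c : R, forall N, \sum_(k < N) `|(M ^+ k) i j| <= c.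
  have [c le_c] := sumM i j; exists (complex.Re c) => N.
  suff : (\sum_(k < N) `|(M ^+ k) i j|)%:C%C <= c.
    by rewrite lecE => /andP[].
  apply: le_trans (le_c N); rewrite rmorph_sum /=; apply: ler_sum => k _.
  apply: le_trans (normc_ge_Re _).
  by rewrite -[map_mx _ M ^+ k](rmorphXn (map_mx (real_complex R))) mxE.
have [c le_c] := choice sumM.
exists (\sum_j c j * `|z j 0|) => N.
have iterE k : iter k (mulmx M) z = M ^+ k *m z.
  elim: k => [|k IHk]; first by rewrite expr0 mul1mx.
  by rewrite iterS IHk mulmxA exprS.
apply: (@le_trans _ _ (\sum_(k < N) \sum_j `|(M ^+ k) i j| * `|z j 0|)).
  apply: ler_sum => k _; rewrite iterE mxE (le_trans (ler_norm_sum _ _ _)) //.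
  by apply: ler_sum => j _; rewrite normrM.
rewrite exchange_big /=; apply: ler_sum => j _.
by rewrite -mulr_suml ler_wpM2r // le_c.
Qed.

End Summability.

(** * The Riccati map and the cost of lifted trajectories *)

Section LinearQuadraticRegulator.
Context {R : realType} {n m d : nat} (A : 'M[R]_d) (B : 'M[R]_(d, m))
  (C : 'M[R]_(n, d)) (Q : 'M[R]_n) (W : 'M[R]_m).
Hypotheses (Q_posdef : posdef Q) (W_posdef : posdef W).
Implicit Types (P : 'M[R]_d) (z : nat -> 'cV[R]_d) (u : nat -> 'cV[R]_m).

Definition riccati_map P : 'M[R]_d :=
  C^T *m Q *m C + A^T *m P *m A
  - A^T *m P *m B *m invmx (W + B^T *m P *m B) *m B^T *m P *m A.

(* the Hessian, up to the factor 2, of the one-step cost in the input *)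
Local Notation curvature P := (W + B^T *m P *m B).
Local Notation gain := (lqr_gain A B W).
Local Notation cost := (stage_cost Q W).

Lemma curvature_posdef P : psd P -> posdef (curvature P).
Proof. by move=> pP; apply: posdefD_psd => //; apply: psd_congr. Qed.

Lemma cost_ge0 x v : 0 <= cost x v.
Proof.
have [_ Q_ge0] := posdef_psd Q_posdef.
have [_ W_ge0] := posdef_psd W_posdef.
by rewrite /stage_cost addr_ge0.
Qed.

(** One step of dynamic programming: the cost of the input [v] followed by the
    terminal cost [P] is minimal exactly at the feedback [gain P *m x], and its
    minimum is the quadratic form of [riccati_map P]. *)
Lemma completion_of_squares P x v : psd P ->
  cost (C *m x) v + qform P (A *m x + B *m v)
  = qform (riccati_map P) x + qform (curvature P) (v - gain P *m x).
Proof.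
move=> pP; have [sP _] := pP.
have [sS _] := curvature_posdef pP.
have uS := posdef_unitmx (curvature_posdef pP).
set S := W + _ in sS uS *; pose H := B^T *m P *m A; pose G := invmx S *m H.
have HT : H^T = A^T *m P *m B by rewrite /H !trmx_mul trmxK sP mulmxA.
have -> : v - gain P *m x = v + G *m x.
  by rewrite /lqr_gain -/S -!mulmxA -mulNmx opprK /G /H !mulmxA.
have -> : riccati_map P = C^T *m Q *m C + A^T *m P *m A + - (H^T *m invmx S *m H).
  by rewrite /riccati_map -/S HT /H !mulmxA.
have SG : S *m G = H by rewrite /G mulmxA mulmxV // mul1mx.
have GSG : G^T *m S *m G = H^T *m invmx S *m H.
  by rewrite -mulmxA SG /G trmx_mul trmx_inv sS.
have crossP : bform P (A *m x) (B *m v) = bform H v x.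
  by rewrite bform_mulr bform_mull mulmxA -HT bformC trmxK.
have crossS : bform S v (G *m x) = bform H v x by rewrite bform_mulr SG.
rewrite /stage_cost !qform_add // crossP crossS !qform_mul GSG !qformD.
rewrite !qformE bformN; ring.
Qed.

Lemma riccati_map_le P x v : psd P ->
  qform (riccati_map P) x <= cost (C *m x) v + qform P (A *m x + B *m v).
Proof.
move=> pP; rewrite completion_of_squares // lerDl.
by have [_] := posdef_psd (curvature_posdef pP).
Qed.

Lemma riccati_map_gain P x : psd P ->
  cost (C *m x) (gain P *m x) + qform P (A *m x + B *m (gain P *m x))
  = qform (riccati_map P) x.
Proof. by move=> pP; rewrite completion_of_squares // subrr qform0 addr0. Qed.

Lemma riccati_map_psd P : psd P -> psd (riccati_map P).
Proof.
move=> pP; split=> [|x]; last first.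
  rewrite -riccati_map_gain // addr_ge0 ?cost_ge0 //.
  by case: pP.
have [[sP _] [sQ _] [sS _]] := And3 pP Q_posdef (curvature_posdef pP).
rewrite /riccati_map linearB linearD /= !trmx_mul trmx_inv sS !trmxK sP sQ.
by rewrite !mulmxA.
Qed.

(** A minimum over inputs is monotone in the terminal cost: the feedback that is
    optimal for [P'] is a competitor for [P]. *)
Lemma riccati_map_mono P P' : psd P -> psd P' ->
  (forall x, qform P x <= qform P' x) ->
  forall x, qform (riccati_map P) x <= qform (riccati_map P') x.
Proof.
move=> pP pP' leP x; rewrite -(riccati_map_gain _ pP') //.
by apply: le_trans (riccati_map_le x (gain P' *m x) pP) _; rewrite lerD2l.
Qed.

(** [value_iter N] is the matrix of the optimal cost over the horizon [N]. *)
Definition value_iter N := iter N riccati_map 0.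

Lemma psd0 : psd (0 : 'M[R]_d).
Proof. by split=> [|v]; rewrite ?trmx0 ?qform0l. Qed.

Lemma value_iter_psd N : psd (value_iter N).
Proof. by elim: N => [|N IHN]; [exact: psd0 | exact: riccati_map_psd]. Qed.

Lemma value_iter_nondecreasing N x :
  qform (value_iter N) x <= qform (value_iter N.+1) x.
Proof.
elim: N x => [|N IHN] x.
  rewrite qform0l.
  by have [_] := value_iter_psd 1.
exact: riccati_map_mono (value_iter_psd _) (value_iter_psd _) IHN x.
Qed.

Lemma value_iter_le_fixpoint P N x : psd P -> P = riccati_map P ->
  qform (value_iter N) x <= qform P x.
Proof.
move=> pP fixP; elim: N x => [|N IHN] x.
  by rewrite qform0l; case: pP.
by rewrite fixP; apply: riccati_map_mono => //; exact: value_iter_psd.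
Qed.

Definition lifted_trajectory z u : Prop :=
  forall k, z k.+1 = A *m z k + B *m u k.

Lemma value_iter_le_cost N z u : lifted_trajectory z u ->
  qform (value_iter N) (z 0%N) <= \sum_(k < N) cost (C *m z k) (u k).
Proof.
elim: N z u => [|N IHN] z u dyn.
  by rewrite big_ord0 qform0l.
rewrite big_ord_recl /=.
apply: le_trans (riccati_map_le _ (u 0%N) (value_iter_psd N)) _.
rewrite lerD2l -dyn.
exact: (IHN (fun k => z k.+1) (fun k => u k.+1)).
Qed.

Lemma fixpoint_le_cost P N z u : psd P -> P = riccati_map P ->
  lifted_trajectory z u ->
  qform P (z 0%N) <= \sum_(k < N) cost (C *m z k) (u k) + qform P (z N).
Proof.
move=> pP fixP dyn; elim: N => [|N IHN]; first by rewrite big_ord0 add0r.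
apply: le_trans IHN _; rewrite big_ord_recr /= -addrA lerD2l {1}fixP dyn.
exact: riccati_map_le.
Qed.

Lemma fixpoint_closed_loop_cost P N z : psd P -> P = riccati_map P ->
  lifted_trajectory z (fun k => gain P *m z k) ->
  \sum_(k < N) cost (C *m z k) (gain P *m z k) + qform P (z N)
  = qform P (z 0%N).
Proof.
move=> pP fixP dyn; elim: N => [|N <-]; first by rewrite big_ord0 add0r.
by rewrite big_ord_recr /= -addrA dyn riccati_map_gain // -fixP.
Qed.

(** If [qform P x = 0] then both the stage cost and the cost to go of the
    optimal feedback vanish; hence the input and the output are zero, the next
    state is [A *m x], and it has zero cost again. All outputs of the free
    motion are then zero, and observability applies. *)
Lemma fixpoint_posdef P : observable A C -> psd P -> P = riccati_map P ->
  posdef P.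
Proof.
move=> obs pP fixP; have [sP P_ge0] := pP; split=> // x x0.
rewrite lt_neqAle P_ge0 andbT eq_sym; apply: contra x0 => /eqP Px0.
have [_ Q_ge0] := posdef_psd Q_posdef.
have [_ W_ge0] := posdef_psd W_posdef.
have step y : qform P y = 0 -> C *m y = 0 /\ qform P (A *m y) = 0.
  move=> Py0; have := riccati_map_gain y pP.
  rewrite -fixP Py0 /stage_cost => /eqP.
  rewrite paddr_eq0 ?addr_ge0 // paddr_eq0 // => /andP[/andP[/eqP Cy /eqP Wy]].
  have -> := posdef_eq0 W_posdef Wy.
  by rewrite mulmx0 addr0 (posdef_eq0 Q_posdef Cy) => /eqP.
have iter0 k : qform P (iter k (mulmx A) x) = 0.
  by elim: k => [|k /step[]].
have iter_0 k : iter k (mulmx A) (0 : 'cV[R]_d) = 0.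
  by elim: k => [//|k IHk]; rewrite iterS IHk mulmx0.
apply/eqP/obs => k; have [-> _] := step _ (iter0 k).
by rewrite iter_0 mulmx0.
Qed.

Lemma riccati_map_cvg (X : nat -> 'M[R]_d) P :
  (forall k, psd (X k)) -> psd P -> mx_cvg X P ->
  mx_cvg (fun k => riccati_map (X k)) (riccati_map P).
Proof.
move=> pX pP XP.
have cst := @mx_cvg_cst R.
have XS : mx_cvg (fun k => curvature (X k)) (curvature P).
  by do ![apply: mx_cvgD | apply: mx_cvgM | exact: cst | exact: XP].
have uX k : curvature (X k) \in unitmx.
  exact/posdef_unitmx/curvature_posdef.
have uP : curvature P \in unitmx by exact/posdef_unitmx/curvature_posdef.
have XI := mx_cvg_inv uX uP XS.
by do ![apply: mx_cvgD | apply: mx_cvgN | apply: mx_cvgM | exact: cst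
  | exact: XP | exact: XI].
Qed.

End LinearQuadraticRegulator.

(** * The limit of value iteration *)

Section ValueIterationLimit.
Context {R : realType} {n m d : nat} (A : 'M[R]_d) (B : 'M[R]_(d, m))
  (C : 'M[R]_(n, d)) (Q : 'M[R]_n) (W : 'M[R]_m).
Hypotheses (Q_posdef : posdef Q) (W_posdef : posdef W).

Local Notation gain := (lqr_gain A B W).
Local Notation cost := (stage_cost Q W).
Local Notation ric := (riccati_map A B C Q W).
Local Notation value := (value_iter A B C Q W).

(** Nonnegative sequences satisfy [sum_k a_k b_k <= (sum_k a_k) (sum_k b_k)], so
    summable coordinates have summable products. *)
Lemma summable_qform (G : 'M[R]_d) (z : nat -> 'cV[R]_d) :
  (forall i, exists c, forall N, \sum_(k < N) `|z k i 0| <= c) ->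
  exists b, forall N, \sum_(k < N) qform G (z k) <= b.
Proof.
move=> /choice[c le_c].
exists (\sum_i \sum_j `|G i j| * (c i * c j)) => N.
under eq_bigr do rewrite qformE bform_sumE.
rewrite exchange_big; apply: ler_sum => i _.
rewrite exchange_big; apply: ler_sum => j _.
apply: (@le_trans _ _ (\sum_(k < N) `|G i j| * (`|z k i 0| * `|z k j 0|))).
  apply: ler_sum => k _; rewrite (le_trans (ler_norm _)) // !normrM.
  by rewrite -mulrA mulrCA.
rewrite -mulr_sumr ler_wpM2l //.
apply: le_trans (ler_pM _ _ (le_c i N) (le_c j N)); rewrite ?sumr_ge0 //.
rewrite mulr_suml; apply: ler_sum => k _; rewrite ler_wpM2l //.
by rewrite (bigD1 k) //= lerDl sumr_ge0.
Qed.

(** The optimal cost over a finite horizon is at most the cost of a stabilizing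
    linear feedback, which is bounded independently of the horizon. *)
Lemma value_iter_bounded : stabilizable A B ->
  exists b : 'cV[R]_d -> R, forall N x, qform (value N) x <= b x.
Proof.
move=> [F stF].
have /choice[b le_b] : forall x, exists b, forall N, qform (value N) x <= b.
  move=> x; pose z k := iter k (mulmx (A + B *m F)) x.
  have [b le_b] := summable_qform (C^T *m Q *m C + F^T *m W *m F) (z := z)
    (fun i => schur_stable_summable x i stF).
  exists b => N; apply: le_trans (le_b N).
  have dyn : lifted_trajectory A B z (fun k => F *m z k).
    by move=> k; rewrite /z iterS mulmxDl mulmxA.
  apply: le_trans (value_iter_le_cost C Q_posdef W_posdef N dyn) _.
  by apply: ler_sum => k _; rewrite qformD -!qform_mul.
by exists b.
Qed.

Lemma value_iter_cvg : stabilizable A B ->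
  exists P, [/\ psd P, P = ric P & mx_cvg value P].
Proof.
move=> /value_iter_bounded[b le_b].
have pv := value_iter_psd A B C Q_posdef W_posdef.
have [P vP] : exists P, mx_cvg value P.
  apply: monotone_qform_cvg le_b => [k|k v]; first by case: (pv k).
  exact: value_iter_nondecreasing.
have pP : psd P.
  split=> [|v]; first by apply: mx_cvg_sym vP => k; case: (pv k).
  apply: (ler_cvg_to (cvg_cst 0) (cvg_bform (u := v) (v := v) vP)).
  by apply: nearW => k; have [_ ge0] := pv k; exact: ge0.
exists P; split=> //; apply/matrixP => i j.
apply: (@cvg_unique _ _ (value k.+1 i j @[k --> \oo])) => //.
  by have := vP i j; rewrite -cvg_shiftS.
exact: (riccati_map_cvg W_posdef pv pP vP).
Qed.

(** The optimal feedback spends [qform P (z 0) - qform P (z N)] in [N] steps, but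
    at least [qform (value N) (z 0)], which tends to [qform P (z 0)]. *)
Lemma closed_loop_value_vanishes P z : psd P -> P = ric P -> mx_cvg value P ->
  lifted_trajectory A B z (fun k => gain P *m z k) ->
  qform P (z N) @[N --> \oo] --> 0.
Proof.
move=> psdP fixP vP dyn.
have gap0 : qform P (z 0%N) - qform (value N) (z 0%N) @[N --> \oo] --> 0.
  rewrite -(subrr (qform P (z 0%N))).
  by apply: cvgB; [exact: cvg_cst | exact: cvg_bform].
apply: (squeeze_cvgr _ (cvg_cst 0) gap0); apply: nearW => N.
have [_ -> /=] := psdP; rewrite lerBrDr addrC.
rewrite -(fixpoint_closed_loop_cost W_posdef N psdP fixP dyn).
by rewrite lerD2r; exact: (value_iter_le_cost C Q_posdef W_posdef N dyn).
Qed.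

(** Run the feedback of [P] for [N] steps and pay [P'] at the end: the cost is at
    least [qform P' x], and it is at most [qform P x] plus a terminal cost that
    vanishes since [P] dominates [P']. *)
Lemma fixpoint_le_limit P P' : posdef P -> P = ric P -> mx_cvg value P ->
  psd P' -> P' = ric P' -> forall x, qform P' x <= qform P x.
Proof.
move=> pP fixP vP pP' fixP' x; have psdP := posdef_psd pP.
pose z k := iter k (mulmx (A + B *m gain P)) x.
have dyn : lifted_trajectory A B z (fun k => gain P *m z k).
  by move=> k; rewrite /z iterS mulmxDl mulmxA.
have [c le_c] := qform_le_posdef P' pP.
have bound0 : qform P x + c * qform P (z N) @[N --> \oo] --> qform P x.
  rewrite -[X in _ --> X]addr0 -[X in _ --> _ + X](mulr0 c).
  apply: cvgD; first exact: cvg_cst.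
  apply: cvgM; first exact: cvg_cst.
  exact: closed_loop_value_vanishes.
apply: (ler_cvg_to (cvg_cst _) bound0); apply: nearW => N.
apply: le_trans (fixpoint_le_cost W_posdef N pP' fixP' dyn) _.
apply: lerD => //.
rewrite -[x in leRHS]/(z 0%N).
rewrite -(fixpoint_closed_loop_cost W_posdef N psdP fixP dyn).
by rewrite lerDl; case: psdP.
Qed.

(** Any other solution lies above all value iterates by monotonicity, hence
    above their limit [P]; it lies below [P] by [fixpoint_le_limit]. *)
Lemma limit_unique P P' : posdef P -> P = ric P -> mx_cvg value P ->
  psd P' -> P' = ric P' -> P' = P.
Proof.
move=> pP fixP vP pP' fixP'; have psdP := posdef_psd pP.
apply: qform_inj; [by case: pP' | by case: psdP |] => x.
apply/le_anti; rewrite fixpoint_le_limit //=.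
apply: (ler_cvg_to (cvg_bform (u := x) (v := x) vP) (cvg_cst _)).
apply: nearW => N.
exact: value_iter_le_fixpoint.
Qed.

End ValueIterationLimit.

Unset Implicit Arguments.

Theorem lemma2 (R : realType) (n m nz : nat)
    (f : 'cV[R]_n * 'cV[R]_m -> 'cV[R]_n) (Psi : 'cV[R]_n -> 'cV[R]_nz)
    (A : 'M[R]_nz) (B : 'M[R]_(nz, m)) (C : 'M[R]_(n, nz))
    (Q : 'M[R]_n) (W : 'M[R]_m)
    (f_C1 : continuously_differentiable f)
    (f0 : f (0, 0) = 0)
    (le_n_nz : (n <= nz)%N)
    (Psi_cont : continuous Psi)
    (Psi0 : Psi 0 = 0)
    (C_Psi : forall x : 'cV[R]_n, C *m Psi x = x)
    (AB_stab : stabilizable A B)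
    (AC_obs : observable A C)
    (Q_posdef : posdef Q)
    (W_posdef : posdef W)
    (no_error : forall (x : 'cV[R]_n) (u : 'cV[R]_m),
        Psi (f (x, u)) = A *m Psi x + B *m u) :
  exists P : 'M[R]_nz,
    [/\ posdef P,
        riccati A B C Q W P,
        (forall P' : 'M[R]_nz, posdef P' -> riccati A B C Q W P' -> P' = P)
      & globally_optimal_policy f (stage_cost Q W)
          (fun x : 'cV[R]_n => lqr_gain A B W P *m Psi x)].
Proof.
have [P [psdP fixP vP]] := value_iter_cvg C Q_posdef W_posdef AB_stab.
have pP := fixpoint_posdef Q_posdef W_posdef AC_obs psdP fixP.
exists P; split=> // [P' pP' fixP'|x ustar].
  exact: (limit_unique Q_posdef W_posdef pP fixP vP (posdef_psd pP')).
(* the lift of every trajectory of f obeys the linear dynamics *)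
have lift u : lifted_trajectory A B (fun k => Psi (trajectory f x u k)) u.
  by move=> k; exact: no_error.
have term_ge0 u k : (0 <= (stage_cost Q W (trajectory f x u k) (u k))%:E)%E.
  by rewrite lee_fin; exact: cost_ge0.
have costE u N : (\sum_(0 <= k < N)
      (stage_cost Q W (trajectory f x u k) (u k))%:E)%E =
    (\sum_(k < N) stage_cost Q W (C *m Psi (trajectory f x u k)) (u k))%:E.
  rewrite sumEFin big_mkord; congr (_%:E); apply: eq_bigr => k _.
  by rewrite C_Psi.
have cost_ge u : ((qform P (Psi x))%:E <= total_cost f (stage_cost Q W) x u)%E.
  (* each partial sum dominates the optimal cost over the same horizon *)
  have cvgP : (qform (value_iter A B C Q W N) (Psi x))%:E @[N --> \oo]
      --> (qform P (Psi x))%:E.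
    by apply: cvg_EFin; [exact: nearW | exact: cvg_bform].
  rewrite -(cvg_lim _ cvgP) //; apply: lime_le.
    by apply/cvg_ex; eexists; exact: cvgP.
  apply: nearW => N; apply: le_trans (nneseries_lim_ge N _) => //.
  rewrite costE lee_fin.
  exact: (value_iter_le_cost C Q_posdef W_posdef N (lift u)).
have ustarE k : ustar k = lqr_gain A B W P *m Psi (trajectory f x ustar k).
  rewrite /ustar; congr (_ *m Psi _).
  by elim: k => //= k <-.
have cost_le : (total_cost f (stage_cost Q W) x ustar <= (qform P (Psi x))%:E)%E.
  apply: lime_le; first exact: is_cvg_nneseries.
  apply: nearW => N; rewrite costE lee_fin.
  have dyn k : Psi (trajectory f x ustar k.+1) =
      A *m Psi (trajectory f x ustar k)
      + B *m (lqr_gain A B W P *m Psi (trajectory f x ustar k)).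
    by rewrite -ustarE; exact: lift.
  rewrite -(fixpoint_closed_loop_cost W_posdef N psdP fixP dyn).
  under eq_bigr do rewrite ustarE.
  by rewrite lerDl; case: psdP.
split=> [|u]; last exact: le_trans (cost_ge u).
rewrite ge0_fin_numE; first exact: le_lt_trans cost_le (ltry _).
exact: nneseries_ge0.
Qed.
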